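(* Let $f:\mathbb{R}\to[0,\infty)$ be a nonnegative, smooth function with $f\in L^1(\mathbb{R})$, such that for every $x\in\mathbb{R}$, $f'(x)=0$ implies $f''(x)\neq 0$. Let $N$ be a positive integer. If $$Q(z)=\frac{|\widehat f(z)|}{\pi\sqrt{10}\int_0^{1/z} f^*(x)\,dx}>N$$ for some $z>0$, then $f'$ has at least $2N-1$ real roots.
   Context: The Fourier transform of $f\in L^1(\mathbb{R})$ is $\widehat f(z)=\int_{\mathbb{R}} f(x)e^{-ixz}\,dx$, $z\in\mathbb{R}$. The decreasing rearrangement of $f$ is $f^*(x)=\inf\{\alpha>0 : |\{t:|f(t)|>\alpha\}|\le x\}$, where $|\cdot|$ of a set is Lebesgue measure. *)

(* Defs.v *)
From HB Require Import structures.
From mathcomp Require Import all_boot all_order all_algebra.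
From mathcomp Require Import all_classical all_reals all_analysis.
From mathcomp Require Import complex.

Set Implicit Arguments.
Unset Strict Implicit.
Unset Printing Implicit Defensive.

Import Order.TTheory GRing.Theory Num.Theory.
Import numFieldNormedType.Exports.

Local Open Scope ring_scope.
Local Open Scope classical_set_scope.
Local Open Scope complex_scope.

Definition smooth (R : realType) (f : R -> R) : Prop :=
  forall (n : nat) (x : R), derivable (f^`(n)) x 1.

(* e^(i t) for real t *)
Definition expi (R : realType) (t : R) : R[i] := cos t +i* sin t.

(* Lebesgue integral over the line of a complex-valued function, computed on
   its real and imaginary parts; it is meaningful when both are integrable. *)
Definition Cintegral (R : realType) (g : R -> R[i]) : R[i] :=
  (\int[lebesgue_measure]_(x in setT) complex.Re (g x)) +i*
  (\int[lebesgue_measure]_(x in setT) complex.Im (g x)).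

Definition fourier (R : realType) (f : R -> R) (z : R) : R[i] :=
  Cintegral (fun x => (f x)%:C * expi (- (x * z))).

(* Extended-real valued: at x = 0 the infimum is over the empty set, hence
   +oo, when f is essentially unbounded. *)
Definition rearrangement (R : realType) (f : R -> R) (x : R) : \bar R :=
  ereal_inf [set a%:E | a in
    [set a : R | 0 < a /\
       (lebesgue_measure [set t : R | (a < `|f t|)%R] <= x%:E)%E]].

(* For f in L^1 the integral in the denominator is finite, being at most the
   L^1 norm of f, so that [fine] loses nothing; it vanishes only if f = 0
   almost everywhere. *)
Definition Q (R : realType) (f : R -> R) (z : R) : R :=
  ComplexField.Normc.normc (fourier f z) /
  (pi * Num.sqrt 10 *
   fine (\int[lebesgue_measure]_(x in `[0%R, z^-1%R]) rearrangement f x)%E).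

(* Main.v *)
Require Import Defs.
From HB Require Import structures.
From mathcomp Require Import all_boot all_order all_algebra finmap.
From mathcomp Require Import all_classical all_reals all_analysis.
From mathcomp Require Import measurable_realfun.
From mathcomp Require Import zify ring lra.

Import Order.TTheory GRing.Theory Num.Theory.
Import numFieldNormedType.Exports.

Local Open Scope ring_scope.
Local Open Scope classical_set_scope.

(** Suppose that [f'] has fewer than [2N - 1] zeros. Between two points where
    [f > a] and around a point where [f <= a], the function [f] has an interior
    minimum, hence a critical point ([superlevel_separated]). Cutting the line
    at the at most [2N - 2] critical points therefore cuts each superlevel set
    [f > a] into at most [2N - 1] intervals.

    Over one bounded interval, [cos (xz)] and [sin (xz)] have an integral at
    most [2 / z] in absolute value, since their antiderivatives are bounded by
    [1 / z]. So the integral of either one over [E_a], the set where [f > a],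
    is at most both [|E_a|] and [(2N - 1) (2 / z)], and a fortiori at most
    [4N min (|E_a|, 1 / z)] ([integral_separated_bound],
    [integral_le_measure]).

    Integrating in [a > 0] relates this to the two sides of the hypothesis. By
    Fubini's theorem, the real and imaginary parts of the transform are the
    integrals over [a] of the integrals just bounded ([layer_cake_bound]). By
    Tonelli's theorem, the integral of [min (|E_a|, T)] over [a] is at most the
    integral of [f^*] over [[0, T]] ([truncated_layer_cake_le]). With [T = 1/z]
    and [J] the latter integral, both parts are at most [4NJ]
    ([oscillatory_bound]), so the modulus is at most [sqrt 32 N J], which is
    less than [pi (sqrt 10) N J] because [pi >= 2]. This contradicts
    [Q f z > N]. *)

Local Notation mu := lebesgue_measure.

(** * Oscillating integrals over unions of intervals *)

(** Finite measure forces the interval to be bounded; the integral is then the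
    difference of two values of [Phi]. *)
Lemma integral_interval_bound (R : realType) (phi Phi : R -> R) (T : R)
    (X : set R) :
  continuous phi -> (forall x : R, is_derive x 1 Phi (phi x)) ->
  (forall x, `|Phi x| <= T) ->
  is_interval X -> (mu X < +oo)%E ->
  (`|\int[mu]_(x in X) (phi x)%:E| <= (2 * T)%:E)%E.
Proof.
move=> cphi dPhi bPhi /is_intervalP -> Xfin.
have T0 : 0 <= T by apply: le_trans (bPhi 0).
have T2 : (0 <= (2 * T)%:E :> \bar R)%E by rewrite lee_fin mulr_ge0.
have mphi (D : set R) : measurable_fun D (EFin \o phi).
  by apply/measurable_EFinP/measurable_funTS; exact: continuous_measurable_fun.
case: (Rhull X) Xfin => [[b0 x|[]] [b1 y|[]]];
  rewrite lebesgue_measure_itv//= ?ltry ?ltNyr// => _;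
  rewrite ?set_itvE ?integral_set0 ?abse0//.
rewrite (integral_itv_bndoo _ _ (mphi `]x, y[)).
have [xy|yx] := ltP x y; last first.
  by rewrite set_itv_ge ?integral_set0 ?abse0// bnd_simp -leNgt.
rewrite -(integral_itv_bndoo true false (mphi `]x, y[)).
have cPhi : continuous Phi.
  by move=> t; apply/differentiable_continuous/derivable1_diffP; case: (dPhi t).
rewrite (@continuous_FTC2 _ _ Phi)//.
- rewrite -EFinB/= lee_fin; apply: le_trans (ler_normB _ _) _.
  by rewrite mulr_natl mulr2n lerD.
- exact: continuous_subspaceT.
- split; first by move=> t _; case: (dPhi t).
  + by apply: cvg_at_right_filter; exact: cPhi.
  + by apply: cvg_at_left_filter; exact: cPhi.
- by move=> t _; rewrite derive1E derive_val.
Qed.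

Lemma integral_le_measure (R : realType) (phi : R -> R) (X : set R) :
  measurable_fun setT phi -> (forall x, `|phi x| <= 1) -> measurable X ->
  (`|\int[mu]_(x in X) (phi x)%:E| <= mu X)%E.
Proof.
move=> mphi phi1 mX.
have mphiX : measurable_fun X (EFin \o phi).
  by apply/measurable_EFinP; exact: measurable_funTS.
apply: le_trans; first exact: le_abse_integral.
rewrite -[leRHS]mul1e -integral_cst//.
apply: ge0_le_integral => //= [|x _]; last by rewrite lee_fin.
apply/measurable_EFinP; apply: measurableT_comp => //.
exact: measurable_funTS.
Qed.

(** The points of [s] cut [X] into at most [size s + 1] intervals, because any
    gap of [X] contains, between the two points of [X] around it, a point of
    [s]. The induction removes the smallest point [r] of [s]: to the left of
    [r] there is no gap, to the right every gap is marked by the tail of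
    [s]. *)
Lemma integral_separated_bound (R : realType) (phi Phi : R -> R) (T : R)
    (s : seq R) (X : set R) :
  continuous phi -> (forall x : R, is_derive x 1 Phi (phi x)) ->
  (forall x, `|Phi x| <= T) ->
  sorted <=%R s -> measurable X -> (mu X < +oo)%E ->
  (forall x y w, X x -> X w -> ~ X y -> x < y < w ->
     exists2 r, r \in s & x < r < w) ->
  (`|\int[mu]_(x in X) (phi x)%:E| <= ((size s).+1%:R * (2 * T))%:E)%E.
Proof.
move=> cphi dPhi bPhi.
elim: s X => [|r s IH] X; rewrite /= => ss mX Xfin sepX.
  rewrite mul1r; apply: (@integral_interval_bound _ _ Phi) => //.
  apply/is_intervalPlt => x y Xx Xy z xzy; apply: contrapT => Xz.
  by have [] := sepX _ _ _ Xx Xy Xz xzy.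
have sr : all (>= r) s.
  by move: ss; rewrite path_sortedE; [case/andP|exact: le_trans].
have mL : measurable (X `&` `]-oo, r]) by exact: measurableI.
have mR : measurable (X `&` `]r, +oo[) by exact: measurableI.
have XE : X = (X `&` `]-oo, r]) `|` (X `&` `]r, +oo[).
  rewrite -setIUr -itv_bndbnd_setU//.
  by rewrite set_itvE setIT.
have mphi (D : set R) : measurable_fun D (EFin \o phi).
  by apply/measurable_EFinP/measurable_funTS; exact: continuous_measurable_fun.
have fin Y : measurable Y -> Y `<=` X -> (mu Y < +oo)%E.
  by move=> mY YX; apply: le_lt_trans Xfin; rewrite le_measure ?inE.
have bL : (`|\int[mu]_(x in X `&` `]-oo, r]) (phi x)%:E| <= (2 * T)%:E)%E.
  apply: (@integral_interval_bound _ _ Phi) => //; last first.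
    by apply: fin => //; exact: subIsetl.
  apply/is_intervalPlt => x w [Xx _] [Xw +] y xyw.
  rewrite /= in_itv/= => wr; have [xy yw] := andP xyw.
  split; last by rewrite /= in_itv/= (le_trans (ltW yw)).
  apply: contrapT => Xy.
  have [t + /andP[_ tw]] := sepX _ _ _ Xx Xw Xy xyw.
  rewrite inE => /predU1P[tr|/(allP sr)].
    by move: tw; rewrite tr ltNge wr.
  by rewrite /= leNgt (lt_le_trans tw).
have bR : (`|\int[mu]_(x in X `&` `]r, +oo[) (phi x)%:E|
            <= ((size s).+1%:R * (2 * T))%:E)%E.
  apply: IH => //; first exact: path_sorted ss.
    by apply: fin => //; exact: subIsetl.
  move=> x y w [Xx] /=; rewrite in_itv/= andbT => rx [Xw _] nXy xyw.
  have Xy : ~ X y.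
    move=> Xy; apply: nXy; split => //=; rewrite in_itv/= andbT.
    by case/andP: xyw => /(lt_trans rx).
  have [t + xtw] := sepX _ _ _ Xx Xw Xy xyw.
  rewrite inE => /predU1P[tr|ts]; last by exists t.
  by move: xtw; rewrite tr => /andP[/(lt_trans rx)]; rewrite ltxx.
have dLR : [disjoint X `&` `]-oo, r] & X `&` `]r, +oo[].
  apply/disj_setPS => x [[_ /=]]; rewrite in_itv/= => xr [_].
  by rewrite /= in_itv/= andbT ltNge xr.
have -> : (\int[mu]_(x in X) (phi x)%:E =
    \int[mu]_(x in X `&` `]-oo, r]) (phi x)%:E +
    \int[mu]_(x in X `&` `]r, +oo[) (phi x)%:E)%E.
  by rewrite {1}XE; exact: (@integral_setU _ _ R mu _ _ _ mL mR (mphi _) dLR).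
apply: le_trans (lee_abs_add _ _) _.
by rewrite -nat1r mulrDl mul1r EFinD leeD.
Qed.

(** * Layer-cake bounds *)

(** The integral of a nonnegative function is a supremum over the simple
    functions below it, so monotonicity asks for no measurability. This serves
    to compare with integrals of [rearrangement f], an infimum over an
    uncountable family of levels. *)
Lemma ge0_integral_mono (d : measure_display) (T : measurableType d)
    (R : realType) (m : {measure set T -> \bar R}) (D : set T)
    (f g : T -> \bar R) :
  (forall x, D x -> (0 <= f x)%E) -> (forall x, D x -> (f x <= g x)%E) ->
  (\int[m]_(x in D) f x <= \int[m]_(x in D) g x)%E.
Proof.
move=> f0 fg.
have g0 x : D x -> (0 <= g x)%E.
  by move=> Dx; apply: le_trans (f0 _ Dx) (fg _ Dx).
rewrite !ge0_integralE//; apply: ereal_sup_le => _ [h /= hf <-].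
exists h => //= x; apply: le_trans (hf x) _.
by rewrite !patchE; case: ifPn => // /set_mem /fg.
Qed.

(** Cavalieri's principle: both sides are the product measure of [A]. *)
Lemma integral_xsection_ysection (d1 d2 : measure_display)
    (T1 : measurableType d1) (T2 : measurableType d2) (R : realType)
    (m1 : {sigma_finite_measure set T1 -> \bar R})
    (m2 : {sigma_finite_measure set T2 -> \bar R}) (A : set (T1 * T2)) :
  measurable A ->
  (\int[m1]_x m2 (xsection A x) = \int[m2]_y m1 (ysection A y))%E.
Proof.
move=> mA; have := indic_fubini_tonelli m1 m2 mA.
by rewrite indic_fubini_tonelli_FE// indic_fubini_tonelli_GE.
Qed.

Lemma measurable_subgraph (R : realType) (g : R -> R) :
  measurable_fun setT g -> measurable [set p : R * R | p.1 < g p.2].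
Proof.
move=> mg.
have : measurable_fun setT (fun p : R * R => p.1 < g p.2).
  by apply: measurable_fun_ltr => //; exact: measurableT_comp.
by move=> /(_ measurableT [set true]); rewrite setTI; exact.
Qed.

Lemma measurable_superlevel (R : realType) (g : R -> R) (a : R) :
  measurable_fun setT g -> measurable [set t | a < g t].
Proof.
move=> mg; have : measurable_fun setT (fun t : R => a < g t).
  by apply: measurable_fun_ltr.
by move=> /(_ measurableT [set true]); rewrite setTI; exact.
Qed.

(** The superlevel sets are the sections of a measurable subgraph. *)
Lemma measurable_distribution (R : realType) (g : R -> R) :
  measurable_fun setT g ->
  measurable_fun setT (fun a : R => mu [set t : R | a < g t]).
Proof.
move=> mg.
have := measurable_fun_xsection (@lebesgue_measure R)
  (measurable_subgraph _ _ mg).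
by apply: eq_measurable_fun => a _ /=; congr mu; apply/seteqP; split=> t /=;
  rewrite /xsection/= inE.
Qed.

(** A level [a] with [|{|f| > a}| <= x], as in the infimum defining [f^*(x)],
    bounds from above every level whose superlevel set has measure greater
    than [x]. *)
Lemma levels_measure_le_rearrangement (R : realType) (f : R -> R) (x : R) :
  measurable_fun setT f ->
  (mu [set a : R | (0 < a)%R /\ (x%:E < mu [set t : R | (a < `|f t|)%R])%E]
     <= rearrangement f x)%E.
Proof.
move=> mf; apply: le_ereal_inf_tmp => _ [a [a0 fax] <-].
have mf' : measurable_fun setT (fun t => `|f t|) by exact: measurableT_comp.
have mA : measurable
    [set b : R | (0 < b)%R /\ (x%:E < mu [set t : R | (b < `|f t|)%R])%E].
  rewrite [X in measurable X](_ : _ = `]0, +oo[ `&`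
      (setT `&` [set b : R | (x%:E < mu [set t : R | (b < `|f t|)%R])%E])).
    apply: measurableI => //; apply: measurable_lte => //.
    exact: measurable_distribution.
  by rewrite setTI; apply/seteqP; split => b /=; rewrite in_itv/= andbT.
have sub : [set b : R | (0 < b)%R /\ (x%:E < mu [set t : R | (b < `|f t|)%R])%E]
    `<=` `[0, a].
  move=> b [b0 xb]; rewrite /= in_itv/= (ltW b0)/= leNgt; apply/negP => ab.
  move: xb; rewrite ltNge => /negP; apply; apply: le_trans fax.
  apply: le_measure; rewrite ?inE; try exact: measurable_superlevel.
  by move=> t /=; exact: lt_trans.
apply: (@le_trans _ _ (mu `[0, a])); first by rewrite le_measure ?inE.
by rewrite lebesgue_measure_itv/= lte_fin a0 oppr0 adde0.
Qed.

(** Both sides are compared with the area of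
    [A = {(a, x) | a > 0, 0 <= x <= T, x < |{|f| > a}|}]: its section at [a]
    contains an interval of length [min (|{|f| > a}|, T)], and its section at
    [x] has measure at most [f^*(x)] by [levels_measure_le_rearrangement]. *)
Lemma truncated_layer_cake_le (R : realType) (f : R -> R) (T : R) :
  measurable_fun setT f -> 0 < T ->
  (\int[mu]_(a in `]0%R, +oo[) mine (mu [set t : R | (a < `|f t|)%R]) T%:E
     <= \int[mu]_(x in `[0%R, T]) rearrangement f x)%E.
Proof.
move=> mf T0.
pose D (a : R) := mu [set t : R | (a < `|f t|)%R].
have mf' : measurable_fun setT (fun t => `|f t|) by exact: measurableT_comp.
have mD : measurable_fun setT D by exact: measurable_distribution.
pose A := [set p : R * R | [/\ 0 < p.1, 0 <= p.2 <= T & (p.2%:E < D p.1)%E]].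
have mA : measurable A.
  rewrite [X in measurable X](_ : _ = `]0, +oo[ `*` `[0, T] `&`
      (setT `&` [set p : R * R | (p.2%:E < D p.1)%E])).
    apply: measurableI; first exact: measurableX.
    apply: measurable_lte => //; last exact: measurableT_comp.
    by apply/measurable_EFinP; exact: measurable_snd.
  rewrite setTI; apply/seteqP; split => p /=; rewrite !in_itv/= andbT.
    by case=> *; split.
  by case=> -[].
have D0 a : (0 <= D a)%E by exact: measure_ge0.
have xA a : 0 < a -> (mine (D a) T%:E <= mu (xsection A a))%E.
  move=> a0; have mxA : measurable (xsection A a) by exact: measurable_xsection.
  have [c [c0 cT cD]] : exists c : R,
      [/\ 0 <= c, c <= T & mine (D a) T%:E = c%:E].
    have : mine (D a) T%:E \is a fin_num.
      rewrite ge0_fin_numE; first by rewrite gt_min ltry orbT.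
      by rewrite le_min D0 lee_fin ltW.
    move=> /fineK E; exists (fine (mine (D a) T%:E)); split => //.
      by rewrite -lee_fin E le_min D0 lee_fin ltW.
    by rewrite -lee_fin E ge_min lexx orbT.
  (* The half-open interval avoids the point x = |{|f| > a}|, where the strict
     inequality defining A fails. *)
  rewrite cD; apply: (@le_trans _ _ (mu `[0, c[)).
    rewrite lebesgue_measure_itv/= lte_fin; case: ltP => [_|].
      by rewrite oppr0 adde0.
    by rewrite lee_fin.
  rewrite le_measure ?inE// => t /=; rewrite in_itv/= => /andP[t0 tc].
  rewrite /xsection/= inE; split => //=.
    by rewrite t0 ltW// (lt_le_trans tc).
  by apply: (@lt_le_trans _ _ c%:E); rewrite ?lte_fin// -cD ge_min lexx.
have yA x : (mu (ysection A x) <= ((rearrangement f) \_ `[0%R, T]) x)%E.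
  rewrite patchE; case: ifPn => [xT|/negP xT].
    apply: le_trans (levels_measure_le_rearrangement _ _ x mf).
    apply: le_measure; rewrite ?inE; first exact: measurable_ysection.
      rewrite [X in measurable X](_ : _ = `]0, +oo[ `&`
          (setT `&` [set b : R | (x%:E < D b)%E])).
        by apply: measurableI => //; apply: measurable_lte.
      by rewrite setTI; apply/seteqP; split => b /=; rewrite in_itv/= andbT.
    by move=> a; rewrite /ysection/= inE => -[].
  rewrite (_ : ysection A x = set0) ?measure0//.
  apply/seteqP; split => // a; rewrite /ysection/= inE => -[_ /= x0T _].
  by apply: xT; rewrite inE/= in_itv.
have fub : (\int[mu]_a mu (xsection A a) = \int[mu]_x mu (ysection A x))%E.
  exact: (integral_xsection_ysection _ _ _ _ _ mu mu A mA).
apply: (@le_trans _ _ (\int[mu]_a mu (xsection A a))%E).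
  rewrite integral_mkcond; apply: ge0_integral_mono => a _.
    by apply: erestrict_ge0 => b _; rewrite le_min D0 lee_fin ltW.
  rewrite patchE; case: ifPn => [|_]; last exact: measure_ge0.
  by rewrite inE/= in_itv/= andbT => /xA.
have step : (\int[mu]_x mu (ysection A x) <=
    \int[mu]_(x in `[0%R, T]) rearrangement f x)%E.
  by rewrite [leRHS]integral_mkcond; apply: ge0_integral_mono => x _.
apply: le_trans step.
by move: fub => /eqP; rewrite eq_le => /andP[+ _].
Qed.

(** Fubini's theorem for [phi x] on the region [0 < a < f x], whose [x]-sections
    give [f x * phi x] and whose [a]-sections are the superlevel sets. *)
Lemma layer_cake_bound (R : realType) (f phi : R -> R) :
  (forall x, 0 <= f x) -> mu.-integrable setT (EFin \o f) ->
  measurable_fun setT phi -> (forall x, `|phi x| <= 1) ->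
  (`|\int[mu]_x (f x * phi x)%:E| <=
     \int[mu]_(a in `]0%R, +oo[)
       `|\int[mu]_(x in [set t | (a < f t)%R]) (phi x)%:E|)%E.
Proof.
move=> f0 intf mphi phi1.
have mf : measurable_fun setT f by case/integrableP : intf => /measurable_EFinP.
pose S := [set p : R * R | 0 < p.2 < f p.1].
have mS : measurable S.
  have m1 : measurable_fun setT (fun p : R * R => 0 < p.2).
    by apply: measurable_fun_ltr.
  have m2 : measurable_fun setT (fun p : R * R => p.2 < f p.1).
    apply: measurable_fun_ltr; first exact: measurable_snd.
    exact: (measurableT_comp mf measurable_fst).
  rewrite [X in measurable X](_ : _ =
    (fun p : R * R => 0 < p.2) @^-1` [set true] `&`
    (fun p : R * R => p.2 < f p.1) @^-1` [set true]); last first.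
    apply/seteqP; split => [p /andP[]//|p [/= + +]].
    by rewrite /S/= => -> ->.
  apply: measurableI; rewrite -[X in measurable X]setTI; [exact: m1|exact: m2].
pose g (p : R * R) := (phi p.1 * \1_S p)%:E.
have mg : measurable_fun setT g.
  apply/measurable_EFinP; apply: measurable_funM; first exact: measurableT_comp.
  exact: measurable_indic.
have Sx x : xsection S x = `]0, f x[.
  by apply/seteqP; split => a /=; rewrite /xsection/= inE /S/= in_itv.
have Sa a : 0 < a -> ysection S a = [set t | a < f t].
  by move=> a0; apply/seteqP; split => t /=; rewrite /ysection/= inE /S/= a0.
have intS x : (\int[mu]_a (\1_S (x, a))%:E = (f x)%:E)%E.
  have := congr1 (@^~ x) (indic_fubini_tonelli_FE mu mS).
  rewrite /fubini_F/= => ->; rewrite Sx lebesgue_measure_itv/= lte_fin.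
  case: ltP => [_|fx0]; first by rewrite oppr0 adde0.
  by congr EFin; apply/eqP; rewrite eq_le fx0 f0.
have mSx x : measurable_fun setT (fun a : R => (\1_S (x, a))%:E : \bar R).
  by apply/measurable_EFinP; apply: measurableT_comp => //;
    exact: measurable_indic.
have gx x : (\int[mu]_a g (x, a) = (f x * phi x)%:E)%E.
  rewrite /g/=.
  under eq_integral do rewrite EFinM.
  rewrite integralZl//.
    by rewrite intS -EFinM mulrC.
  apply/integrableP; split; first exact: mSx.
  under eq_integral do rewrite gee0_abs ?lee_fin//.
  by rewrite intS ltry.
have ga a : (\int[mu]_x g (x, a) =
    if (0 < a)%R then \int[mu]_(x in [set t | (a < f t)%R]) (phi x)%:E
    else 0)%E.
  case: ifPn => a0.
    rewrite [RHS]integral_mkcond; apply: eq_integral => x _.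
    rewrite /g patchE /= indicE -mem_ysection Sa//.
    by case: ifPn => _; rewrite ?mulr1 ?mulr0.
  apply: integral0_eq => x _; rewrite /g/= indicE memNset ?mulr0//.
  by move=> /andP[/= a0']; rewrite a0' in a0.
have intg : (mu \x mu)%E.-integrable setT g.
  apply/integrable12ltyP => //.
  have /integrableP[_] := intf; apply: le_lt_trans.
  apply: ge0_integral_mono => x _; first by apply: integral_ge0.
  rewrite [leRHS]gee0_abs ?lee_fin//= -(intS x).
  apply: ge0_integral_mono => a _ //.
  by rewrite /g/= lee_fin normrM [X in _ * X]ger0_norm ?ler_piMl.
have -> : (\int[mu]_x (f x * phi x)%:E = \int[mu]_a \int[mu]_x g (x, a))%E.
  have := Fubini intg => <-.
  by apply: eq_integral => x _; rewrite gx.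
apply: le_trans; first apply: le_abse_integral => //.
  exact: (measurable_fubini_G intg).
rewrite [leRHS]integral_mkcond; apply: ge0_integral_mono => a _ //.
rewrite ga patchE; case: ifPn => a0.
  by rewrite mem_set//= in_itv/= a0.
by rewrite abse0; case: ifPn.
Qed.

(** * Superlevel sets and critical points *)

(** The minimum of [f] on [[x, w]] is at most [f y <= a], so it is not attained
    at an endpoint; an interior minimum is a critical point. *)
Lemma superlevel_separated (R : realType) (f : R -> R) (a x y w : R) :
  (forall t, derivable f t 1) ->
  a < f x -> a < f w -> ~ a < f y -> x < y < w ->
  exists2 r, f^`() r = 0 & x < r < w.
Proof.
move=> df ax aw /negP; rewrite -leNgt => ya /andP[xy yw].
have xw : x <= w by rewrite ltW// (lt_trans xy).
have cf : {within `[x, w], continuous f}.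
  apply: continuous_subspaceT => t.
  by apply/differentiable_continuous/derivable1_diffP.
have [c cxw cmin] := EVT_min xw cf.
have cy : f c <= f y by apply: cmin; rewrite in_itv/= !ltW.
have ca : f c <= a := le_trans cy ya.
have cxw' : x < c < w.
  move: cxw; rewrite in_itv/= !le_eqVlt => /andP[/orP[/eqP xc|->]].
    by move: ax; rewrite xc ltNge ca.
  move=> /orP[/eqP cw|->//].
  by move: aw; rewrite -cw ltNge ca.
exists c => //.
have := @derive1_at_min R f x w c xw; rewrite derive1E => h.
apply: derive_val; apply: h.
- by move=> t _; exact: df.
- by rewrite in_itv.
- move=> t; rewrite in_itv/= => /andP[xt tw].
  by apply: cmin; rewrite in_itv/= !ltW.
Qed.

Lemma few_elements_sorted (R : realType) (A : set R) (n : nat) :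
  ~ (`I_n #<= A)%card ->
  exists s : seq R,
    [/\ sorted <=%R s, (size s < n)%N & forall x, A x -> x \in s].
Proof.
move=> nA.
have [|/infiniteP NA] := pselect (finite_set A); last first.
  by exfalso; apply: nA; apply: card_le_trans NA; exact: card_leT.
move=> /finite_fsetP [F AF]; exists (sort <=%R (enum_fset F)); split.
- exact: sort_le_sorted.
- rewrite size_sort ltnNge; apply/negP => nF; apply: nA.
  have /card_eq_fsetP FE : #|` F| = size (enum_fset F) by [].
  by rewrite AF (card_le_eqr FE) card_le_II.
- by move=> x; rewrite AF /= mem_sort.
Qed.

(** The bound that a function with at most [size s] critical points satisfies
    against an oscillating factor [phi] with a primitive bounded by [T]:
    superlevel set by superlevel set, by the minimum of the two available
    estimates. *)
Lemma oscillatory_bound (R : realType) (f phi Phi : R -> R) (T : R)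
    (s : seq R) :
  (forall x, 0 <= f x) -> (forall x, derivable f x 1) ->
  mu.-integrable setT (EFin \o f) ->
  sorted <=%R s -> (forall x, f^`() x = 0 -> x \in s) ->
  0 < T -> continuous phi -> (forall x, `|phi x| <= 1) ->
  (forall x : R, is_derive x 1 Phi (phi x)) -> (forall x, `|Phi x| <= T) ->
  (`|\int[mu]_x (f x * phi x)%:E| <=
     ((size s).+1 * 2)%:R%:E * \int[mu]_(x in `[0%R, T]) rearrangement f x)%E.
Proof.
move=> f0 df intf ss rs T0 cphi phi1 dPhi bPhi.
have mf : measurable_fun setT f by case/integrableP : intf => /measurable_EFinP.
have mphi : measurable_fun setT phi by exact: continuous_measurable_fun.
have T0E : (0 <= T%:E)%E by rewrite lee_fin ltW.
have K0 : (0 <= ((size s).+1 * 2)%:R :> R) by exact: ler0n.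
apply: le_trans; first exact: layer_cake_bound.
apply: (@le_trans _ _ (((size s).+1 * 2)%:R%:E *
    \int[mu]_(a in `]0%R, +oo[) mine (mu [set t : R | (a < `|f t|)%R]) T%:E)%E);
  last first.
  by apply: lee_wpmul2l; [rewrite lee_fin|exact: truncated_layer_cake_le].
have normf : (fun t => `|f t|) = f by apply/funext => t; rewrite ger0_norm.
have mmin : measurable_fun (`]0%R, +oo[%classic : set R)
    (fun a : R => mine (mu [set t : R | (a < `|f t|)%R]) T%:E).
  apply: measurable_mine => //; apply: measurable_funTS.
  by apply: measurable_distribution; rewrite normf.
rewrite -ge0_integralZl//; last first.
  by move=> a _; rewrite le_min measure_ge0.
apply: ge0_integral_mono => [//|a]; rewrite /= in_itv/= andbT => a0.
have -> : [set t : R | (a < `|f t|)%R] = [set t : R | (a < f t)%R].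
  by apply/seteqP; split => t /=; rewrite ger0_norm.
set X := [set t : R | _].
have mX : measurable X by exact: measurable_superlevel.
(* Markov's inequality. *)
have finX : (mu X < +oo)%E.
  have /integrableP[mEf] := intf; apply: contraTT.
  rewrite -!leNgt !leye_eq => /eqP XE.
  have := @le_integral_abse _ _ R mu _ measurableT _ a mEf a0.
  rewrite setTI => h; rewrite -leye_eq; apply: le_trans h.
  have mY : measurable [set x | (a%:E <= `|(EFin \o f) x|)%E].
    rewrite -[X in measurable X]setTI; apply: emeasurable_fun_c_infty => //.
    exact: measurableT_comp.
  have : (a%:E * mu X <= a%:E * mu [set x | (a%:E <= `|(EFin \o f) x|)%E])%E.
    apply: lee_wpmul2l; first by rewrite lee_fin ltW.
    apply: le_measure; [exact: mem_set|exact: mem_set|move=> t /= at_].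
    by rewrite lee_fin ger0_norm// ltW.
  by rewrite XE mulry gtr0_sg// mul1e.
have b1 : (`|\int[mu]_(x in X) (phi x)%:E| <= mu X)%E.
  exact: integral_le_measure.
have b2 : (`|\int[mu]_(x in X) (phi x)%:E| <= ((size s).+1%:R * (2 * T))%:E)%E.
  apply: (@integral_separated_bound _ _ Phi) => // x y w Xx Xw nXy xyw.
  have [r /rs rs' xrw] := @superlevel_separated _ f a x y w df Xx Xw nXy xyw.
  by exists r.
have [muT|muT] := leP (mu X) T%:E; last first.
  by apply: le_trans b2 _; rewrite -EFinM lee_fin natrM mulrA.
apply: le_trans b1 _; rewrite -[leLHS]mul1e; apply: lee_wpmul2r => //.
by rewrite lee_fin ler1n.
Qed.

(** * The Fourier transform *)

Lemma normc_fourier (R : realType) (f : R -> R) (z : R) :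
  complex.ComplexField.Normc.normc (fourier f z) =
  Num.sqrt ((\int[mu]_x (f x * cos (- (x * z)))) ^+ 2 +
            (\int[mu]_x (f x * sin (- (x * z)))) ^+ 2).
Proof.
rewrite /fourier /Cintegral /=; congr (Num.sqrt (_ ^+ 2 + _ ^+ 2)).
  by apply: eq_Rintegral => x _; rewrite mul0r subr0.
by apply: eq_Rintegral => x _; rewrite mul0r addr0.
Qed.

Theorem mainTheorem3 (R : realType) (f : R -> R) (N : nat)
  (f_ge0 : forall x : R, 0 <= f x)
  (f_smooth : smooth f)
  (f_L1 : lebesgue_measure.-integrable setT (EFin \o f))
  (f_nondeg : forall x : R, f^`() x = 0 -> f^`(2) x <> 0)
  (N_gt0 : (0 < N)%N)
  (Q_gtN : exists z : R, 0 < z /\ N%:R < Q f z) :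
  (`I_(2 * N - 1) #<= [set x : R | f^`() x = 0])%card.
Proof.
apply: contrapT => /few_elements_sorted[s [ss sN rs]].
have [z [z0 QN]] := Q_gtN.
have df x : derivable f x 1 := f_smooth 0%N x.
have zV0 : 0 < z^-1 by rewrite invr_gt0.
pose J := (\int[mu]_(x in `[0%R, z^-1%R]) rearrangement f x)%E.
pose D := fine J.
have J0 : (0 <= J)%E.
  apply: integral_ge0 => x _; apply: le_ereal_inf_tmp => _ [a [a0 _] <-].
  by rewrite lee_fin ltW.
have N0 : 0 < N%:R :> R by rewrite ltr0n.
(* A zero or infinite J makes the denominator of Q, hence Q itself, zero. *)
have D0 : 0 < D.
  rewrite lt_neqAle fine_ge0// andbT; apply/eqP => DE.
  by move: QN; rewrite /Q -/J -/D -DE mulr0 invr0 mulr0 ltNge ltW.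
have JD : J = D%:E.
  by rewrite fineK//; move: D0; rewrite /D; case: (J) J0 => //=; rewrite ltxx.
(* Here size s + 1 <= 2N - 1, and 2 (2N - 1) <= 4N. *)
have bound (phi Phi : R -> R) : continuous phi -> (forall x, `|phi x| <= 1) ->
    (forall x : R, is_derive x 1 Phi (phi x)) -> (forall x, `|Phi x| <= z^-1) ->
    `|\int[mu]_x (f x * phi x)| <= 4 * N%:R * D.
  move=> cphi phi1 dPhi bPhi.
  have := @oscillatory_bound R f phi Phi z^-1 s f_ge0 df f_L1 ss rs zV0
    cphi phi1 dPhi bPhi.
  rewrite -/J JD -EFinM => b.
  have : (`|\int[mu]_x (f x * phi x)%:E| <= (4 * N%:R * D)%:E)%E.
    apply: le_trans b _; rewrite lee_fin ler_pM2r// -natrM ler_nat.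
    by lia.
  rewrite /Rintegral; case: (\int[mu]_x _)%E => [r| |] //=.
have clin : continuous (fun x : R => - (x * z)).
  by move=> x; apply: cvgN; apply: cvgMl; exact: cvg_id.
have bV c : `|c| <= 1 -> `|c / z| <= z^-1.
  by move=> c1; rewrite normrM [X in _ * X]gtr0_norm// ler_piMl// ltW.
have zn0 : z != 0 by exact: lt0r_neq0.
have norm_cos t : `|cos t| <= 1 by rewrite ler_norml cos_geN1 cos_le1.
have norm_sin t : `|sin t| <= 1 by rewrite ler_norml sin_geN1 sin_le1.
have bcos : `|\int[mu]_x (f x * cos (- (x * z)))| <= 4 * N%:R * D.
  apply: (bound _ (fun x => - sin (- (x * z)) / z)) => //.
  - by move=> x; apply: continuous_comp; [exact: clin|exact: continuous_cos].
  - move=> x; apply: is_derive_eq; rewrite !scaler0 !add0r /GRing.scale/=.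
    by field.
  - by move=> x; apply: bV; rewrite normrN; exact: norm_sin.
have bsin : `|\int[mu]_x (f x * sin (- (x * z)))| <= 4 * N%:R * D.
  apply: (bound _ (fun x => cos (- (x * z)) / z)) => //.
  - by move=> x; apply: continuous_comp; [exact: clin|exact: continuous_sin].
  - move=> x; apply: is_derive_eq; rewrite !scaler0 !add0r /GRing.scale/=.
    by field.
  - by move=> x; apply: bV; exact: norm_cos.
move: QN; rewrite /Q -/J -/D normc_fourier.
set a := \int[mu]_x _ in bcos *; set b := \int[mu]_x _ in bsin *.
have pi2 : 2 <= pi :> R by exact: pi_ge2.
have s10 : 0 < Num.sqrt 10 :> R by rewrite sqrtr_gt0.
have den0 : 0 < pi * Num.sqrt 10 * D :> R by rewrite !mulr_gt0// pi_gt0.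
rewrite ltr_pdivlMr// => Nab.
have : (N%:R * (pi * Num.sqrt 10 * D)) ^+ 2 < Num.sqrt (a ^+ 2 + b ^+ 2) ^+ 2.
  by rewrite ltr_pXn2r// nnegrE ?sqrtr_ge0// mulr_ge0// ltW.
rewrite sqr_sqrtr ?addr_ge0 ?sqr_ge0// ltNge => /negP; apply.
have sq_le c : `|c| <= 4 * N%:R * D -> c ^+ 2 <= 16 * (N%:R * D) ^+ 2.
  move=> cb; have -> : 16 * (N%:R * D) ^+ 2 = (4 * N%:R * D) ^+ 2 by ring.
  by rewrite -real_normK ?num_real// lerXn2r ?nnegrE// (le_trans _ cb).
have -> : (N%:R * (pi * Num.sqrt 10 * D)) ^+ 2 =
    10 * pi ^+ 2 * (N%:R * D) ^+ 2 :> R.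
  rewrite -[X in _ = X * _ * _](@sqr_sqrtr R 10)//; ring.
apply: (@le_trans _ _ (32 * (N%:R * D) ^+ 2)).
  by have := sq_le _ bcos; have := sq_le _ bsin; lra.
apply: ler_wpM2r; first exact: sqr_ge0.
by rewrite expr2; nra.
Qed.
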